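(* Let $\mu$ be the monotone dependence measure (defined in the context). All random variables below are real-valued and of arbitrary type (discrete, continuous or mixed), and every pair of random variables to which $\mu$ is applied, and every subcopula to which $\mu$ is applied, is assumed to be non-trivial, i.e. the underlying subcopula $S$ does not satisfy $W_S=\Pi_S=M_S$. Then: (a) $\mu_{X,Y}$ is defined for every pair $(X,Y)$ of arbitrary type random variables on a common probability space; (b) $-1\le \mu_{X,Y}\le +1$, $\mu_{X,X}=+1$, and $\mu_{X,-X}=-1$; (c) $\mu_{X,Y}=\mu_{Y,X}$; (d) if $X$ and $Y$ are independent then $\mu_{X,Y}=0$; (e) if $\mu_{X,Y}\neq 0$ then $\mu_{X,Y}$ has opposite sign to $\mu_{X,-Y}$ and to $\mu_{-X,Y}$; (f) if $S_1,S_2$ are subcopulas with the same domain $\mathrm{Dom}\,S_1=D=\mathrm{Dom}\,S_2$ and $S_1(u,v)\le S_2(u,v)$ for all $(u,v)\in D$, then $\mu(S_1)\le\mu(S_2)$; (g) if $P[Y=\varphi(X)]=1$ with $\varphi$ nondecreasing (respectively nonincreasing) then $\mu_{X,Y}=+1$ (respectively $\mu_{X,Y}=-1$); (h) if $X$ and $Y$ are positively quadrant dependent (respectively negatively quadrant dependent) then $\mu_{X,Y}\ge 0$ (respectively $\mu_{X,Y}\le 0$).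
   Context: Let $\mathbb{I}=[0,1]$ and $\overline{\mathbb{R}}=[-\infty,+\infty]$. A (bivariate) subcopula is a function $S:D_1\times D_2\to\mathbb{I}$, where $\{0,1\}\subseteq D_i\subseteq\mathbb{I}$ for $i=1,2$, such that for all $u,u_1,u_2\in D_1$ and $v,v_1,v_2\in D_2$: (i) $S(u,0)=0=S(0,v)$; (ii) $S(u,1)=u$ and $S(1,v)=v$; (iii) $S(u_2,v_2)-S(u_2,v_1)-S(u_1,v_2)+S(u_1,v_1)\ge 0$ whenever $u_1\le u_2$ and $v_1\le v_2$. Write $\mathrm{Dom}\,S=D_1\times D_2$. Distribution functions are defined on $\overline{\mathbb{R}}$: $F_X(x)=P(X\le x)$ with $F_X(-\infty)=0$, $F_X(+\infty)=1$, and $F_{X,Y}(x,y)=P(X\le x,\,Y\le y)$, similarly extended. $\mathrm{Ran}\,F$ denotes the range of $F$ on $\overline{\mathbb{R}}$, so it contains $0$ and $1$. By Sklar's theorem, for every random vector $(X,Y)$ there is a unique subcopula $S$ with domain $\mathrm{Ran}\,F_X\times\mathrm{Ran}\,F_Y$ such that $F_{X,Y}(x,y)=S(F_X(x),F_Y(y))$ for all $x,y\in\overline{\mathbb{R}}$; it is called the underlying subcopula of $(X,Y)$. On $\mathbb{I}^2$ let $W(u,v)=\max\{u+v-1,0\}$, $M(u,v)=\min\{u,v\}$, $\Pi(u,v)=uv$; for a subcopula $S$, $W_S,M_S,\Pi_S$ denote the restrictions of $W,M,\Pi$ to $\mathrm{Dom}\,S$ (these are subcopulas). For a subcopula $S$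 define $$d(S)=\sup_{\mathrm{Dom}\,S}\{S-\Pi_S\}-\sup_{\mathrm{Dom}\,S}\{\Pi_S-S\}.$$ The monotone dependence measure of a subcopula $S$ is $$\mu(S)=\begin{cases} d(S)/d(M_S) & \text{if } d(S)\ge 0 \text{ and } M_S\ne\Pi_S,\\ -d(S)/d(W_S) & \text{if } d(S)\le 0\text{ and } W_S\neq\Pi_S,\\ 0 & \text{if } W_S=\Pi_S=M_S,\end{cases}$$ and for random variables $X,Y$ with underlying subcopula $S$ one sets $\mu_{X,Y}=\mu(S)$. $X$ and $Y$ with underlying subcopula $S$ are positively quadrant dependent if $P(X\le x,Y\le y)\ge P(X\le x)P(Y\le y)$ for all $x,y$, equivalently $S(u,v)\ge\Pi_S(u,v)$ for all $(u,v)\in\mathrm{Dom}\,S$; negatively quadrant dependent is defined with the inequalities reversed. *)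

(* Defs.v *)
From HB Require Import structures.
From mathcomp Require Import all_boot all_order all_algebra.
From mathcomp Require Import all_classical all_reals all_analysis.
From mathcomp Require Import measurable_realfun.
From mathcomp Require Import lra.

Set Implicit Arguments.
Unset Strict Implicit.
Unset Printing Implicit Defensive.

Import Order.TTheory GRing.Theory Num.Theory.
Import numFieldNormedType.Exports.

Local Open Scope classical_set_scope.
Local Open Scope ring_scope.

(* The function is total on R; only its values on [D1 `*` D2] are constrained,
   and subcopulas are compared with [sceq] below rather than with [=].        *)
Record is_subcopula (R : realType) (D1 D2 : set R) (S : R -> R -> R) : Prop :=
  IsSubcopula {
  dom1_sub : [set 0; 1] `<=` D1 /\ D1 `<=` `[0, 1];
  dom2_sub : [set 0; 1] `<=` D2 /\ D2 `<=` `[0, 1];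
  sc_range : forall u v, D1 u -> D2 v -> 0 <= S u v <= 1;
  sc_u0 : forall u, D1 u -> S u 0 = 0;
  sc_0v : forall v, D2 v -> S 0 v = 0;
  sc_u1 : forall u, D1 u -> S u 1 = u;
  sc_1v : forall v, D2 v -> S 1 v = v;
  sc_2incr : forall u1 u2 v1 v2, D1 u1 -> D1 u2 -> D2 v1 -> D2 v2 ->
    u1 <= u2 -> v1 <= v2 -> 0 <= S u2 v2 - S u2 v1 - S u1 v2 + S u1 v1 }.

Record subcopula (R : realType) := Subcopula {
  dom1 : set R;
  dom2 : set R;
  scfun :> R -> R -> R;
  scP : is_subcopula dom1 dom2 scfun }.

Section restrictions.
Variables (R : realType) (S : subcopula R).

Lemma dom1_01 u : dom1 S u -> 0 <= u <= 1.
Proof. by move/(dom1_sub (scP S)).2; rewrite /= in_itv. Qed.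

Lemma dom2_01 v : dom2 S v -> 0 <= v <= 1.
Proof. by move/(dom2_sub (scP S)).2; rewrite /= in_itv. Qed.

Lemma W_subproof :
  is_subcopula (dom1 S) (dom2 S) (fun u v => Num.max (u + v - 1) 0).
Proof.
split; [exact: dom1_sub (scP S) | exact: dom2_sub (scP S) | | | | | |].
- by move=> u v /dom1_01 hu /dom2_01 hv; case: (leP (u + v - 1) 0) => h; lra.
- by move=> u /dom1_01 hu; case: (leP (u + 0 - 1) 0) => h; lra.
- by move=> v /dom2_01 hv; case: (leP (0 + v - 1) 0) => h; lra.
- by move=> u /dom1_01 hu; case: (leP (u + 1 - 1) 0) => h; lra.
- by move=> v /dom2_01 hv; case: (leP (1 + v - 1) 0) => h; lra.
- move=> u1 u2 v1 v2 _ _ _ _ hu hv.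
  case: (leP (u2 + v2 - 1) 0) => ?; case: (leP (u2 + v1 - 1) 0) => ?;
  case: (leP (u1 + v2 - 1) 0) => ?; case: (leP (u1 + v1 - 1) 0) => ?; lra.
Qed.

Lemma M_subproof : is_subcopula (dom1 S) (dom2 S) (fun u v => Num.min u v).
Proof.
split; [exact: dom1_sub (scP S) | exact: dom2_sub (scP S) | | | | | |].
- by move=> u v /dom1_01 hu /dom2_01 hv; case: (leP u v) => h; lra.
- by move=> u /dom1_01 hu; case: (leP u 0) => h; lra.
- by move=> v /dom2_01 hv; case: (leP 0 v) => h; lra.
- by move=> u /dom1_01 hu; case: (leP u 1) => h; lra.
- by move=> v /dom2_01 hv; case: (leP 1 v) => h; lra.
- move=> u1 u2 v1 v2 _ _ _ _ hu hv.
  case: (leP u2 v2) => ?; case: (leP u2 v1) => ?;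
  case: (leP u1 v2) => ?; case: (leP u1 v1) => ?; lra.
Qed.

Lemma Pi_subproof : is_subcopula (dom1 S) (dom2 S) (fun u v => u * v).
Proof.
split; [exact: dom1_sub (scP S) | exact: dom2_sub (scP S) | | | | | |].
- move=> u v /dom1_01/andP[? ?] /dom2_01/andP[? ?].
  by rewrite mulr_ge0 // mulr_ile1.
- by move=> u _; rewrite mulr0.
- by move=> v _; rewrite mul0r.
- by move=> u _; rewrite mulr1.
- by move=> v _; rewrite mul1r.
- by move=> u1 u2 v1 v2 _ _ _ _ hu hv; nra.
Qed.

Definition W_ : subcopula R := Subcopula W_subproof.
Definition M_ : subcopula R := Subcopula M_subproof.
Definition Pi_ : subcopula R := Subcopula Pi_subproof.

End restrictions.

Section measure.
Variable R : realType.
Implicit Type S : subcopula R.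

Definition sceq S S' := [/\ dom1 S = dom1 S', dom2 S = dom2 S' &
  forall u v, dom1 S u -> dom2 S v -> S u v = S' u v].

Definition diffs S S' : set R :=
  [set S u v - S' u v | u in dom1 S & v in dom2 S].

Definition dep S : R := sup (diffs S (Pi_ S)) - sup (diffs (Pi_ S) S).

Definition nontrivial S := ~ (sceq (W_ S) (Pi_ S) /\ sceq (Pi_ S) (M_ S)).

(* The defining clauses overlap when [dep S = 0], and it is not immediate that
   they cover all cases; hence a relation, of which [mu] is the value.        *)
Definition is_mu S (m : R) :=
  [\/ [/\ 0 <= dep S, ~ sceq (M_ S) (Pi_ S) & m = dep S / dep (M_ S)],
      [/\ dep S <= 0, ~ sceq (W_ S) (Pi_ S) & m = - dep S / dep (W_ S)]
    | [/\ sceq (W_ S) (Pi_ S), sceq (Pi_ S) (M_ S) & m = 0]].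

Definition mu S : R := get [set m | is_mu S m].

(* In the library [sup] and division are total: these are the conditions under
   which the expressions in [is_mu S] have their usual meaning.               *)
Definition mu_meaningful S :=
  [/\ forall S', S' = S \/ S' = M_ S \/ S' = W_ S ->
        has_sup (diffs S' (Pi_ S')) /\ has_sup (diffs (Pi_ S') S'),
      ~ sceq (M_ S) (Pi_ S) -> dep (M_ S) != 0 &
      ~ sceq (W_ S) (Pi_ S) -> dep (W_ S) != 0].

End measure.

Section random_variables.
Variables (R : realType) (d : measure_display) (T : measurableType d).
Variable P : probability T R.
Implicit Types X Y : {RV P >-> R}.

Definition df X (x : \bar R) : R := fine (P [set w | ((X w)%:E <= x)%E]).

Definition jdf X Y (x y : \bar R) : R :=
  fine (P [set w | ((X w)%:E <= x)%E /\ ((Y w)%:E <= y)%E]).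

Definition underlying X Y (S : subcopula R) :=
  [/\ dom1 S = range (df X), dom2 S = range (df Y) &
      forall x y : \bar R, jdf X Y x y = S (df X x) (df Y y)].

Definition nontrivial_rv X Y := exists2 S, underlying X Y S & nontrivial S.

Definition is_mu_rv X Y (m : R) := exists2 S, underlying X Y S & is_mu S m.

Definition mu_rv X Y : R := get [set m | is_mu_rv X Y m].

Definition independent X Y := forall A B : set R, measurable A -> measurable B ->
  P (X @^-1` A `&` Y @^-1` B) = (P (X @^-1` A) * P (Y @^-1` B))%E.

Definition PQD X Y := forall x y : R,
  (P [set w | (X w <= x)%R] * P [set w | (Y w <= y)%R] <=
   P [set w | (X w <= x)%R /\ (Y w <= y)%R])%E.

Definition NQD X Y := forall x y : R,
  (P [set w | (X w <= x)%R /\ (Y w <= y)%R] <=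
   P [set w | (X w <= x)%R] * P [set w | (Y w <= y)%R])%E.

End random_variables.

(* Main.v *)
Require Import Defs.
From HB Require Import structures.
From mathcomp Require Import all_boot all_order all_algebra.
From mathcomp Require Import all_classical all_reals all_analysis.
From mathcomp Require Import measurable_realfun.
From mathcomp Require Import lra.

Import Order.TTheory GRing.Theory Num.Theory.
Import numFieldNormedType.Exports.

Local Open Scope classical_set_scope.
Local Open Scope ring_scope.

(** A subcopula satisfies [W <= S <= M], and [d] is monotone in [S], so [d(S)]
    lies between [d(W) <= 0] and [d(M) >= 0]; moreover [M = Pi], [W = Pi] and
    triviality are equivalent, because each equality at a point [(u, v)] forces
    [u] or [v] to be [0] or [1].  Hence [mu] is a well-defined rescaling of [d]
    with the same sign.  Monotone functional dependence makes the events
    [X <= x] and [Y <= y] nested (resp. disjoint or covering) up to a null set,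
    so [S = M] (resp. [S = W]).  Replacing [Y] by [-Y] exchanges the two suprema
    in [d]: the values [P (Y < y)] and [P (Y <= y)] approximate each other. *)

Section subcopula_theory.
Local Set Implicit Arguments.
Local Unset Strict Implicit.
Context {R : realType}.
Implicit Types S : subcopula R.

(** * Fréchet-Hoeffding bounds *)

Lemma dom1_0 S : dom1 S 0. Proof. by apply: (dom1_sub (scP S)).1; left. Qed.
Lemma dom1_1 S : dom1 S 1. Proof. by apply: (dom1_sub (scP S)).1; right. Qed.
Lemma dom2_0 S : dom2 S 0. Proof. by apply: (dom2_sub (scP S)).1; left. Qed.
Lemma dom2_1 S : dom2 S 1. Proof. by apply: (dom2_sub (scP S)).1; right. Qed.

(** The 2-increasing inequality on the rectangle from [(u, 0)] to [(1, v)] bounds [S u v] by [v]; on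
    the one from [(0, v)] to [(u, 1)] it gives the bound [u]. *)
Lemma subcopula_le_M S u v : dom1 S u -> dom2 S v -> S u v <= M_ S u v.
Proof.
move=> hu hv; have /andP[u0 u1] := dom1_01 hu; have /andP[v0 v1] := dom2_01 hv.
have := sc_2incr (scP S) hu (dom1_1 S) (dom2_0 S) hv u1 v0.
have := sc_2incr (scP S) (dom1_0 S) hu hv (dom2_1 S) u0 v1.
rewrite (sc_u1 (scP S) hu) (sc_1v (scP S) hv) (sc_u0 (scP S) hu).
rewrite (sc_0v (scP S) hv) (sc_u1 (scP S) (dom1_0 S)) (sc_u0 (scP S) (dom1_1 S)).
by rewrite /= le_min => ? ?; apply/andP; split; lra.
Qed.

(** The rectangle from [(u, v)] to [(1, 1)] gives the bound [u + v - 1]; the range condition gives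
    [0]. *)
Lemma W_le_subcopula S u v : dom1 S u -> dom2 S v -> W_ S u v <= S u v.
Proof.
move=> hu hv; have /andP[u0 u1] := dom1_01 hu; have /andP[v0 v1] := dom2_01 hv.
have := sc_2incr (scP S) hu (dom1_1 S) hv (dom2_1 S) u1 v1.
have /andP[? _] := sc_range (scP S) hu hv.
rewrite (sc_u1 (scP S) (dom1_1 S)) (sc_1v (scP S) hv) (sc_u1 (scP S) hu).
by rewrite /= ge_max => ?; apply/andP; split; lra.
Qed.

(** * Suprema of differences and monotonicity of [dep] *)

Section same_domain.
Variables S S' : subcopula R.
Hypotheses (e1 : dom1 S = dom1 S') (e2 : dom2 S = dom2 S').

Lemma has_sup_diffs : has_sup (diffs S S').
Proof.
split.
  by exists (S 0 0 - S' 0 0), 0; [exact: dom1_0|exists 0; first exact: dom2_0].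
exists 1 => _ [u hu] [v hv] <-.
have := sc_range (scP S) hu hv.
by rewrite e1 in hu; rewrite e2 in hv; have := sc_range (scP S') hu hv; lra.
Qed.

Lemma le_sup_diffs u v : dom1 S u -> dom2 S v ->
  S u v - S' u v <= sup (diffs S S').
Proof.
move=> hu hv; apply: ub_le_sup; first exact: has_sup_diffs.2.
by exists u => //; exists v.
Qed.

Lemma sup_diffs_ge0 : 0 <= sup (diffs S S').
Proof.
(* Both functions vanish at [(0, 0)], so the difference takes the value [0]. *)
have := le_sup_diffs (dom1_0 S) (dom2_0 S).
rewrite (sc_u0 (scP S) (dom1_0 S)) (sc_u0 (scP S')) ?subrr //; exact: dom1_0.
Qed.

Lemma sup_diffs_le c :
  (forall u v, dom1 S u -> dom2 S v -> S u v - S' u v <= c) ->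
  sup (diffs S S') <= c.
Proof.
move=> h; apply: ge_sup; first exact: has_sup_diffs.1.
by move=> _ [u hu] [v hv] <-; exact: h.
Qed.

End same_domain.

Lemma sup_diffs_eq0 S S' : dom1 S = dom1 S' -> dom2 S = dom2 S' ->
  (forall u v, dom1 S u -> dom2 S v -> S u v <= S' u v) ->
  sup (diffs S S') = 0.
Proof.
move=> e1 e2 h; apply/eqP; rewrite eq_le sup_diffs_ge0 // andbT.
by apply: sup_diffs_le => // u v hu hv; rewrite subr_le0 h.
Qed.

(** Raising the subcopula raises the first supremum in [dep] and lowers the second. *)
Lemma le_dep S1 S2 : dom1 S1 = dom1 S2 -> dom2 S1 = dom2 S2 ->
  (forall u v, dom1 S1 u -> dom2 S1 v -> S1 u v <= S2 u v) ->
  dep S1 <= dep S2.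
Proof.
move=> e1 e2 h; rewrite /dep lerB //.
- apply: sup_diffs_le => // u v hu hv.
  apply: (@le_trans _ _ (S2 u v - Pi_ S2 u v)); first by rewrite lerD2r h.
  by apply: le_sup_diffs => //; rewrite -?e1 -?e2.
- apply: sup_diffs_le => //= u v; rewrite -e1 -e2 => hu hv.
  apply: (@le_trans _ _ (Pi_ S1 u v - S1 u v)); first by rewrite lerB // h.
  exact: (@le_sup_diffs (Pi_ S1) S1).
Qed.

Lemma sceq_dep S1 S2 : sceq S1 S2 -> dep S1 = dep S2.
Proof.
move=> [e1 e2 h]; apply/eqP; rewrite eq_le !le_dep // -?e1 -?e2 // => u v hu hv;
  by rewrite h.
Qed.

Lemma dep_Pi S : dep (Pi_ S) = 0.
Proof. by rewrite /dep !sup_diffs_eq0 // subrr. Qed.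

Lemma Pi_le_dep_ge0 S : (forall u v, dom1 S u -> dom2 S v -> u * v <= S u v) ->
  0 <= dep S.
Proof. by move=> h; rewrite -(dep_Pi S) le_dep. Qed.

Lemma le_Pi_dep_le0 S : (forall u v, dom1 S u -> dom2 S v -> S u v <= u * v) ->
  dep S <= 0.
Proof. by move=> h; rewrite -(dep_Pi S) le_dep. Qed.

Lemma dep_le_M S : dep S <= dep (M_ S).
Proof. by apply: le_dep => // u v; exact: (@subcopula_le_M S). Qed.

Lemma dep_ge_W S : dep (W_ S) <= dep S.
Proof. by apply: le_dep => // u v; exact: (@W_le_subcopula S). Qed.

(** [Pi_ S] is itself a subcopula on the same domain, so the general upper bound applies to it. *)
Lemma Pi_le_M S u v : dom1 S u -> dom2 S v -> u * v <= M_ S u v.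
Proof. exact: (@subcopula_le_M (Pi_ S)). Qed.

Lemma W_le_Pi S u v : dom1 S u -> dom2 S v -> W_ S u v <= u * v.
Proof. exact: (@W_le_subcopula (Pi_ S)). Qed.

(** * Triviality and the signs of the extreme values of [dep] *)

Lemma sceq_M_Pi S : dep (M_ S) <= 0 -> sceq (M_ S) (Pi_ S).
Proof.
(* Since [Pi <= M], the second supremum is [0]; a nonpositive first one then forces [M <= Pi]
   pointwise. *)
rewrite /dep (@sup_diffs_eq0 (Pi_ (M_ S))) // ?subr0; last first.
  by move=> u v hu hv; exact: Pi_le_M.
move=> h; split => // u v hu hv; apply/eqP; rewrite eq_le Pi_le_M // andbT.
rewrite -subr_le0; apply: le_trans h.
exact: (@le_sup_diffs (M_ S) (Pi_ (M_ S))).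
Qed.

Lemma sceq_W_Pi S : 0 <= dep (W_ S) -> sceq (W_ S) (Pi_ S).
Proof.
rewrite /dep (@sup_diffs_eq0 (W_ S)) // ?sub0r; last first.
  by move=> u v hu hv; exact: W_le_Pi.
rewrite oppr_ge0 => h; split => // u v hu hv.
apply/eqP; rewrite eq_le W_le_Pi // -subr_le0; apply: le_trans h.
exact: (@le_sup_diffs (Pi_ (W_ S)) (W_ S)).
Qed.

(** Both equalities factor: [u + v - 1 = u * v] is [(u - 1) * (v - 1) = 0], and [min u v = u * v] is
    [u * (v - 1) = 0] or [(u - 1) * v = 0]. Each therefore holds exactly when [u] or [v] is [0] or
    [1]. *)
Lemma W_Pi_M_eq (u v : R) : 0 <= u <= 1 -> 0 <= v <= 1 ->
  (Num.max (u + v - 1) 0 = u * v) <-> (Num.min u v = u * v).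
Proof.
move=> hu hv.
have E : (Num.max (u + v - 1) 0 == u * v) = [|| u == 0, u == 1, v == 0 | v == 1].
  apply/eqP/idP => [|/or4P[]/eqP->].
  - case: (leP (u + v - 1) 0) => _ e; apply/or4P.
      have /eqP : u * v = 0 by [].
      by rewrite mulf_eq0 => /orP[]h; [apply: Or41|apply: Or43].
    have /eqP : (u - 1) * (v - 1) = 0 by lra.
    by rewrite mulf_eq0 !subr_eq0 => /orP[]h; [apply: Or42|apply: Or44].
  - by rewrite mul0r; case: leP => ?; lra.
  - by rewrite mul1r; case: leP => ?; lra.
  - by rewrite mulr0; case: leP => ?; lra.
  - by rewrite mulr1; case: leP => ?; lra.
have F : (Num.min u v == u * v) = [|| u == 0, u == 1, v == 0 | v == 1].
  apply/eqP/idP => [|/or4P[]/eqP->].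
  - case: (leP u v) => _ e; apply/or4P.
      have /eqP : u * (v - 1) = 0 by lra.
      by rewrite mulf_eq0 !subr_eq0 => /orP[]h; [apply: Or41|apply: Or44].
    have /eqP : (u - 1) * v = 0 by lra.
    by rewrite mulf_eq0 !subr_eq0 => /orP[]h; [apply: Or42|apply: Or43].
  - by rewrite mul0r; case: leP => ?; lra.
  - by rewrite mul1r; case: leP => ?; lra.
  - by rewrite mulr0; case: leP => ?; lra.
  - by rewrite mulr1; case: leP => ?; lra.
by split => /eqP; rewrite ?E ?F => ?; apply/eqP; rewrite ?E ?F.
Qed.

Lemma sceq_W_M S : sceq (W_ S) (Pi_ S) <-> sceq (M_ S) (Pi_ S).
Proof.
by split=> -[_ _ h]; split=> // u v hu hv; apply/W_Pi_M_eq => //;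
  [exact: dom1_01 hu|exact: dom2_01 hv|exact: h|
   exact: dom1_01 hu|exact: dom2_01 hv|exact: h].
Qed.

Lemma sceqC S S' : sceq S S' -> sceq S' S.
Proof. by move=> [e1 e2 h]; split=> // u v; rewrite -e1 -e2 => ? ?; rewrite h. Qed.

Lemma nontrivial_M S : nontrivial S <-> ~ sceq (M_ S) (Pi_ S).
Proof.
split=> h h'; apply: h; last by apply/sceqC; exact: h'.2.
by split; [apply/sceq_W_M|exact: sceqC].
Qed.

(** This fixes the signs of the two denominators of [mu], on which the bounds, sign and monotonicity
    of [mu_val] rest. *)
Lemma nontrivial_dep S : nontrivial S -> dep (W_ S) < 0 < dep (M_ S).
Proof.
move/nontrivial_M => h; rewrite !ltNge; apply/andP; split; apply/negP.
  by move=> /sceq_W_Pi /sceq_W_M.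
by move=> /sceq_M_Pi.
Qed.

(* Also correct for trivial [S], where all three [dep]s vanish and [0 / 0 = 0]. *)
Definition mu_val S : R :=
  if 0 <= dep S then dep S / dep (M_ S) else - dep S / dep (W_ S).

(** For trivial [S], [dep S] is squeezed between two zeros. Otherwise the third clause is excluded,
    and the first two overlap only at [dep S = 0], where both give [0]. *)
Lemma is_muE S m : is_mu S m <-> m = mu_val S.
Proof.
have [[hW hM]|ntS] := EM (sceq (W_ S) (Pi_ S) /\ sceq (Pi_ S) (M_ S)).
  have dW : dep (W_ S) = 0 by rewrite (sceq_dep hW) dep_Pi.
  have dM : dep (M_ S) = 0 by rewrite -(sceq_dep hM) dep_Pi.
  have dS : dep S = 0.
    by apply/eqP; rewrite eq_le -[X in _ <= X]dM dep_le_M -dW dep_ge_W.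
  rewrite /mu_val dS lexx mul0r; split; last by move=> ->; apply: Or33.
  by move=> [[_ _ ->]|[_ _ ->]|[_ _ ->]]; rewrite ?dS ?oppr0 ?mul0r.
have /andP[W0 M0] := nontrivial_dep ntS.
have ntM : ~ sceq (M_ S) (Pi_ S) by exact/nontrivial_M.
have ntW : ~ sceq (W_ S) (Pi_ S) by move/sceq_W_M.
rewrite /mu_val; split.
  move=> [[-> _ ->]//|[h _ ->]|[/ntW//]].
  case: ifPn => // h'; have -> : dep S = 0 by apply/eqP; rewrite eq_le h h'.
  by rewrite oppr0 !mul0r.
by case: leP => h ->; [apply: Or31|apply: Or32]; split=> //; exact: ltW.
Qed.

Lemma muE S : mu S = mu_val S.
Proof. by apply/is_muE; apply: (@getI _ _ (mu_val S)); exact/is_muE. Qed.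

Lemma mu_meaningfulP S : mu_meaningful S.
Proof.
split.
- by move=> S' _; split; exact: has_sup_diffs.
- by move=> /nontrivial_M/nontrivial_dep/andP[_ /gt_eqF ->].
- move=> h; have /nontrivial_dep/andP[/lt_eqF ->//] : nontrivial S.
  by move=> [].
Qed.

Lemma sceq_mu_val S S' : sceq S S' -> mu_val S = mu_val S'.
Proof.
move=> SS'; have [e1 e2 _] := SS'.
have dM : dep (M_ S) = dep (M_ S') by apply: sceq_dep; split.
have dW : dep (W_ S) = dep (W_ S') by apply: sceq_dep; split.
by rewrite /mu_val (sceq_dep SS') dM dW.
Qed.

(** * Bounds, sign, monotonicity and symmetry of [mu_val] *)

Lemma mu_val_bound S : nontrivial S -> -1 <= mu_val S <= 1.
Proof.
move=> /nontrivial_dep/andP[W0 M0]; rewrite /mu_val.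
have := dep_le_M S; have := dep_ge_W S; case: (leP 0 (dep S)) => h hW hM.
  rewrite ler_pdivrMr // mul1r hM andbT; apply: (@le_trans _ _ 0); first lra.
  by rewrite divr_ge0 // ltW.
rewrite ler_ndivrMr // ler_ndivlMr //; lra.
Qed.

Lemma sgr_mu_val S : nontrivial S -> Num.sg (mu_val S) = Num.sg (dep S).
Proof.
move=> /nontrivial_dep/andP[W0 M0]; rewrite /mu_val.
case: leP => _; rewrite sgrM sgrV; first by rewrite (gtr0_sg M0) mulr1.
by rewrite sgrN (ltr0_sg W0) mulrN1 opprK.
Qed.

(** The denominators depend on the domain only, so both sides are values of one nondecreasing
    function of [dep]. *)
Lemma le_mu_val S1 S2 : nontrivial S1 ->
  dom1 S1 = dom1 S2 -> dom2 S1 = dom2 S2 ->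
  (forall u v, dom1 S1 u -> dom2 S1 v -> S1 u v <= S2 u v) ->
  mu_val S1 <= mu_val S2.
Proof.
move=> /nontrivial_dep/andP[W0 M0] e1 e2 /(le_dep e1 e2) h.
have dM : dep (M_ S1) = dep (M_ S2) by apply: sceq_dep; split.
have dW : dep (W_ S1) = dep (W_ S2) by apply: sceq_dep; split.
rewrite /mu_val -dM -dW; case: (leP 0 (dep S1)) => h1; case: (leP 0 (dep S2)) => h2.
- by rewrite ler_pM2r // invr_gt0.
- by move: h1 h2; lra.
- apply: (@le_trans _ _ 0); last by rewrite divr_ge0 // ltW.
  by rewrite nmulr_lle0 ?invr_lt0 //; lra.
- by rewrite ler_nM2r ?invr_lt0 // lerN2.
Qed.

Lemma mu_val_M S : nontrivial S -> sceq S (M_ S) -> mu_val S = 1.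
Proof.
move=> /nontrivial_dep/andP[_ M0] h.
by rewrite /mu_val (sceq_dep h) ltW // divff // gt_eqF.
Qed.

Lemma mu_val_W S : nontrivial S -> sceq S (W_ S) -> mu_val S = -1.
Proof.
move=> /nontrivial_dep/andP[W0 _] h.
by rewrite /mu_val (sceq_dep h) leNgt W0 /= mulNr divff // lt_eqF.
Qed.

Lemma mu_val_ge0 S : nontrivial S -> 0 <= dep S -> 0 <= mu_val S.
Proof. by move=> h; rewrite -sgr_ge0 -sgr_mu_val // sgr_ge0. Qed.

Lemma mu_val_le0 S : nontrivial S -> dep S <= 0 -> mu_val S <= 0.
Proof. by move=> h; rewrite -sgr_le0 -sgr_mu_val // sgr_le0. Qed.

Lemma dep_transpose S S' : dom1 S' = dom2 S -> dom2 S' = dom1 S ->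
  (forall u v, dom1 S u -> dom2 S v -> S' v u = S u v) ->
  dep S' = dep S.
Proof.
move=> e1 e2 h; rewrite /dep; congr (sup _ - sup _); rewrite /diffs e1 e2 /=.
  apply/seteqP; split=> _ [u hu] [v hv] <-; exists v => //; exists u => //;
    by rewrite h // mulrC.
apply/seteqP; split=> _ [u hu] [v hv] <-; exists v => //; exists u => //;
  by rewrite h // mulrC.
Qed.

Lemma mu_val_transpose S S' : dom1 S' = dom2 S -> dom2 S' = dom1 S ->
  (forall u v, dom1 S u -> dom2 S v -> S' v u = S u v) ->
  mu_val S' = mu_val S.
Proof.
move=> e1 e2 h; rewrite /mu_val (dep_transpose e1 e2 h).
rewrite (@dep_transpose (M_ S) (M_ S')) //; last by move=> u v *; exact: minC.
rewrite (@dep_transpose (W_ S) (W_ S')) // => u v _ _ /=.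
by rewrite [v + u]addrC.
Qed.

End subcopula_theory.

Section random_variables_theory.
Local Set Implicit Arguments.
Local Unset Strict Implicit.
Context {R : realType} {d : measure_display} {T : measurableType d}.
Variable P : probability T R.
Implicit Types (A B C : set T) (X Y : {RV P >-> R}) (x y : \bar R).

Local Notation pr A := (fine (P A)).

(** * Real-valued probabilities of events *)

Lemma prE A : measurable A -> P A = (pr A)%:E.
Proof. by move=> mA; rewrite fineK // fin_num_measure. Qed.

Lemma pr_ge0 A : 0 <= pr A.
Proof. exact: fine_ge0. Qed.

Lemma prT : pr setT = 1.
Proof. by rewrite probability_setT. Qed.

Lemma pr0 : pr set0 = 0.
Proof. by rewrite measure0. Qed.

Lemma prDI A B : measurable A -> measurable B ->
  pr A = pr (A `\` B) + pr (A `&` B).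
Proof.
move=> mA mB; rewrite {1}(measureDI P mA mB) fineD //; apply: fin_num_measure.
  exact: measurableD.
exact: measurableI.
Qed.

Lemma le_pr A B : measurable A -> measurable B -> A `<=` B -> pr A <= pr B.
Proof.
move=> mA mB AB; rewrite (prDI mB mA) (setIidr AB) lerDr; exact: pr_ge0.
Qed.

Lemma pr_setDI A A' B : measurable A -> measurable A' -> measurable B ->
  A `<=` A' -> pr ((A' `\` A) `&` B) = pr (A' `&` B) - pr (A `&` B).
Proof.
move=> mA mA' mB AA'; apply/eqP; rewrite eq_sym subr_eq; apply/eqP.
rewrite (@prDI (A' `&` B) A) //; last exact: measurableI.
by rewrite setIAC (setIidr AA') !setDE (setIAC A').
Qed.

(** The mass that [B] has in the difference of [A'] and [A] grows with [B]. Taking [set0] or [setT]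
    among the four events yields most of the inequalities between probabilities used below. *)
Lemma pr_2incr A A' B B' :
    measurable A -> measurable A' -> measurable B -> measurable B' ->
    A `<=` A' -> B `<=` B' ->
  0 <= pr (A' `&` B') - pr (A' `&` B) - pr (A `&` B') + pr (A `&` B).
Proof.
move=> mA mA' mB mB' AA' BB'.
have : pr ((A' `\` A) `&` B) <= pr ((A' `\` A) `&` B').
  by apply: le_pr; [apply: measurableI => //; exact: measurableD..|exact: setIS].
by rewrite !pr_setDI //; lra.
Qed.

(** * Distribution functions and the underlying subcopula *)

Definition lev X x : set T := X @^-1` [set r : R | (r%:E <= x)%E].

Lemma measurable_ray x : measurable [set r : R | (r%:E <= x)%E].
Proof.
case: x => [x| |].
- rewrite (_ : [set _ | _] = `]-oo, x]%classic); first exact: measurable_itv.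
  by apply/seteqP; split=> r /=; rewrite in_itv /= lee_fin.
- by rewrite (_ : [set _ | _] = setT) //; apply/seteqP; split=> r //= _; rewrite leey.
- by rewrite (_ : [set _ | _] = set0) //; apply/seteqP; split=> r.
Qed.

Lemma measurable_lev X x : measurable (lev X x).
Proof. exact: measurable_funPTI (measurable_ray x). Qed.
Hint Resolve measurable_lev : core.

Lemma lev_pinfty X : lev X +oo%E = setT.
Proof. by apply/seteqP; split=> w //= _; rewrite /lev /= leey. Qed.

Lemma lev_ninfty X : lev X -oo%E = set0.
Proof. by apply/seteqP; split=> w. Qed.

Lemma lev_le X x x' : (x <= x')%E -> lev X x `<=` lev X x'.
Proof. by move=> xx' w /= /le_trans; exact. Qed.

Lemma dfE X x : df X x = pr (lev X x). Proof. by []. Qed.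

Lemma jdfE X Y x y : jdf X Y x y = pr (lev X x `&` lev Y y). Proof. by []. Qed.

Lemma df_pinfty X : df X +oo%E = 1.
Proof. by rewrite dfE lev_pinfty prT. Qed.

Lemma df_ninfty X : df X -oo%E = 0.
Proof. by rewrite dfE lev_ninfty pr0. Qed.

Lemma df_ge0 X x : 0 <= df X x.
Proof. exact: pr_ge0. Qed.

Lemma df_le1 X x : df X x <= 1.
Proof. by rewrite -prT dfE le_pr. Qed.

Lemma le_df X x x' : (x <= x')%E -> df X x <= df X x'.
Proof. by move=> xx'; rewrite !dfE le_pr //; exact: lev_le. Qed.

Lemma jdfC X Y x y : jdf X Y x y = jdf Y X y x.
Proof. by rewrite !jdfE setIC. Qed.

Lemma jdf_pinfty X Y x : jdf X Y x +oo%E = df X x.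
Proof. by rewrite jdfE lev_pinfty setIT. Qed.

Lemma jdf_ninfty X Y x : jdf X Y x -oo%E = 0.
Proof. by rewrite jdfE lev_ninfty setI0 pr0. Qed.

Lemma jdf_2incr X Y x x' y y' : (x <= x')%E -> (y <= y')%E ->
  0 <= jdf X Y x' y' - jdf X Y x' y - jdf X Y x y' + jdf X Y x y.
Proof. by move=> xx' yy'; rewrite !jdfE pr_2incr //; exact: lev_le. Qed.

(** For [x <= x'], the increment of [jdf] in its first argument lies between [0] and
    [df X x' - df X x]: compare the strip below [y] with the strip above it. Hence [jdf] factors
    through the marginals. *)
Lemma jdf_df_eq X Y x x' y : df X x = df X x' -> jdf X Y x y = jdf X Y x' y.
Proof.
wlog xx' : x x' / (x <= x')%E => [h e|].
  by have /orP[] := le_total x x' => ?; [exact: h|apply/esym/h].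
move=> e; apply/eqP; rewrite eq_le; apply/andP; split.
  by have := jdf_2incr X Y xx' (leNye y); rewrite !jdf_ninfty; lra.
by have := jdf_2incr X Y xx' (leey y); rewrite !jdf_pinfty; lra.
Qed.

Lemma sklar X Y : exists S, underlying X Y S.
Proof.
(* [q Z u] is some point at which [df Z] takes the value [u]. Off the range it is a default,
   harmless because [S] is not constrained there. *)
pose q (Z : {RV P >-> R}) u := get [set x | df Z x = u].
have qK (Z : {RV P >-> R}) x : df Z (q Z (df Z x)) = df Z x.
  exact: (@getI _ [set x' | df Z x' = df Z x] x).
pose S u v := jdf X Y (q X u) (q Y v).
have SE x y : S (df X x) (df Y y) = jdf X Y x y.
  by rewrite /S (@jdf_df_eq _ _ _ x) // jdfC (@jdf_df_eq _ _ _ y) // jdfC.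
have dom (Z : {RV P >-> R}) :
    [set 0; 1] `<=` range (df Z) /\ range (df Z) `<=` `[0, 1].
  split=> [_ [->|->]|_ [x _ <-] /=].
  - by exists -oo%E => //; exact: df_ninfty.
  - by exists +oo%E => //; exact: df_pinfty.
  - by rewrite in_itv /= df_ge0 df_le1.
have scS : is_subcopula (range (df X)) (range (df Y)) S.
  split; try exact: dom.
  - move=> _ _ [x _ <-] [y _ <-]; rewrite SE jdfE pr_ge0 /= -prT.
    by apply: le_pr => //; exact: measurableI.
  - by move=> _ [x _ <-]; rewrite -(df_ninfty Y) SE jdf_ninfty df_ninfty.
  - by move=> _ [y _ <-]; rewrite -(df_ninfty X) SE jdfC jdf_ninfty df_ninfty.
  - by move=> _ [x _ <-]; rewrite -(df_pinfty Y) SE jdf_pinfty.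
  - by move=> _ [y _ <-]; rewrite -(df_pinfty X) SE jdfC jdf_pinfty.
  - move=> _ _ _ _ [x _ <-] [x' _ <-] [y _ <-] [y' _ <-]; rewrite !SE.
    (* The chosen points may be ordered against their values; monotonicity of [df] then makes the
       values equal, and the alternating sum vanishes. *)
    case: (leP x x') => [xx'|/ltW/(le_df X) x'x] h1; last first.
      have e : df X x = df X x' by apply/eqP; rewrite eq_le h1.
      by move=> _; rewrite !(jdf_df_eq _ _ e); lra.
    case: (leP y y') => [yy'|/ltW/(le_df Y) y'y] h2; first exact: jdf_2incr.
    have e : df Y y = df Y y' by apply/eqP; rewrite eq_le h2.
    by rewrite !(jdfC X) !(jdf_df_eq _ _ e); lra.
by exists (Subcopula scS); split=> // x y; rewrite /= SE.
Qed.

Lemma underlying_sceq X Y S S' :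
  underlying X Y S -> underlying X Y S' -> sceq S S'.
Proof.
move=> [d1 d2 e] [d1' d2' e']; split; [by rewrite d1 d1'|by rewrite d2 d2'|].
by move=> u v; rewrite d1 d2 => -[x _ <-] [y _ <-]; rewrite -e -e'.
Qed.

Lemma is_mu_rvE X Y S m : underlying X Y S -> is_mu_rv X Y m <-> m = mu_val S.
Proof.
move=> uS; split=> [[S' uS' /is_muE ->]|->].
  exact: sceq_mu_val (underlying_sceq uS' uS).
by exists S => //; exact/is_muE.
Qed.

Lemma mu_rvE X Y S : underlying X Y S -> mu_rv X Y = mu_val S.
Proof.
move=> uS; apply/(is_mu_rvE _ uS).
by apply: (@getI _ _ (mu_val S)); exact/(is_mu_rvE _ uS).
Qed.

Lemma underlying_transpose X Y S S' : underlying X Y S -> underlying Y X S' ->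
  [/\ dom1 S' = dom2 S, dom2 S' = dom1 S &
      forall u v, dom1 S u -> dom2 S v -> S' v u = S u v].
Proof.
move=> [d1 d2 e] [d1' d2' e']; split; [by rewrite d1' d2|by rewrite d2' d1|].
by move=> u v; rewrite d1 d2 => -[x _ <-] [y _ <-]; rewrite -e -e' jdfC.
Qed.

(** * Reflection of one variable *)

Lemma df_right_continuous Y (y e : R) : 0 < e ->
  exists2 y', y < y' & df Y y'%:E <= df Y y%:E + e.
Proof.
move=> e0.
have cdfE r : cdf Y r = (df Y r%:E)%:E.
  by rewrite dfE -prE.
have : (fun r => df Y r%:E) x @[x --> y^'+] --> df Y y%:E.
  rewrite (_ : (fun _ => _) = fine \o cdf Y).
    by apply: fine_cvg; rewrite -cdfE; exact: cdf_right_continuous.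
  by apply/funext => r /=; rewrite cdfE.
move/cvgr_dist_le => /(_ _ e0) h.
near y^'+ => y'; exists y'; first by near: y'; exact: nbhs_right_gt.
have : `|df Y y%:E - df Y y'%:E| <= e by near: y'.
by rewrite ler_distl => /andP[]; lra.
Unshelve. all: by end_near.
Qed.

(* Passing from [Y] to [-Y] replaces [P (Y <= y)] by the left limits
   [P (Y < y')], which approximate it as [y'] decreases to [y]. *)
Lemma reflect_approx X Y x y (e : R) : 0 < e -> exists z : \bar R,
  `|(jdf X Y x y - df X x * df Y y)
    + (jdf X (- Y) x z - df X x * df (P := P) (- Y) z)| <= e.
Proof.
move=> e0; case: y => [y| |]; last 2 first.
(* At an infinite [y] both deviations from independence are [0], so the opposite infinity serves. *)
- exists -oo%E; rewrite jdf_pinfty df_pinfty jdf_ninfty df_ninfty.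
  by rewrite mulr1 mulr0 !subrr addr0 normr0 ltW.
- exists +oo%E; rewrite jdf_pinfty df_pinfty jdf_ninfty df_ninfty.
  by rewrite mulr1 mulr0 !subrr addr0 normr0 ltW.
have [y' yy' he] := df_right_continuous Y y e0.
(* The event [- Y <= - y'] is the complement of [Y < y'], and the latter lies between [Y <= y] and
   [Y <= y']. *)
exists (- y')%:E.
pose B := Y @^-1` `]-oo, y'[.
have mB : measurable B by exact: measurable_funPTI.
have LE : lev (- Y) (- y')%:E = ~` B.
  apply/seteqP; split=> w; rewrite /lev /B /= in_itv /= lee_fin lerN2 leNgt.
    by move/negP.
  by move=> h; apply/negP.
have mA := measurable_lev X x.
have E1 : jdf X (- Y) x (- y')%:E = df X x - pr (lev X x `&` B).
  by rewrite jdfE LE -setDE dfE (prDI mA mB) addrK.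
have E2 : df (P := P) (- Y) (- y')%:E = 1 - pr B.
  by rewrite dfE LE -setTD -prT (prDI measurableT mB) setTI addrK.
have sub1 : lev Y y%:E `<=` B.
  by move=> w; rewrite /lev /B /= in_itv /= lee_fin => /le_lt_trans; apply.
have sub2 : B `<=` lev Y y'%:E.
  by move=> w; rewrite /lev /B /= in_itv /= lee_fin; exact: ltW.
have := le_pr mB (measurable_lev Y y'%:E) sub2.
have := pr_2incr measurable0 mA (measurable_lev Y y%:E) mB (@sub0set _ _) sub1.
have := pr_2incr mA measurableT (measurable_lev Y y%:E) mB (@subsetT _ _) sub1.
rewrite !setTI !set0I pr0 E1 E2 jdfE.
move: he (df_ge0 X x) (df_le1 X x); rewrite !(dfE Y).
set a := df X x; set F := pr (lev Y y%:E); set F' := pr (lev Y _).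
set j := pr (_ `&` lev _ _); set k := pr (_ `&` B); set G := pr B.
move=> he a0 a1 h1 h2 h3.
(* The quantity to bound is [a * (G - F) - (k - j)], where [0 <= k - j <= G - F <= F' - F <= e] and
   [0 <= a <= 1]. *)
by rewrite ler_norml; apply/andP; split; nra.
Qed.

(** By [reflect_approx], each value of [S - Pi] is, up to any [e > 0], a value of [Pi - S'], and
    likewise with the signs exchanged. *)
Lemma sup_diffs_reflect_le X Y S S' :
    underlying X Y S -> underlying X (- Y) S' ->
  sup (diffs S (Pi_ S)) <= sup (diffs (Pi_ S') S') /\
  sup (diffs (Pi_ S) S) <= sup (diffs S' (Pi_ S')).
Proof.
move=> [d1 d2 E] [d1' d2' E'].
have dom x z : dom1 S' (df X x) /\ dom2 S' (df (P := P) (- Y) z).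
  by rewrite d1' d2'; split; [exists x|exists z].
split; apply: sup_diffs_le => // u v /=; rewrite d1 d2 => -[x _ <-] [y _ <-] /=;
  rewrite -E; apply/ler_addgt0Pr => e e0; have [z] := reflect_approx X Y x y e0;
  rewrite ler_norml; have [h1 h2] := dom x z.
- have := @le_sup_diffs _ (Pi_ S') S' erefl erefl _ _ h1 h2; rewrite -E' /=; lra.
- have := @le_sup_diffs _ S' (Pi_ S') erefl erefl _ _ h1 h2; rewrite -E' /=; lra.
Qed.

Lemma dep_reflect X Y S S' : underlying X Y S -> underlying X (- Y) S' ->
  dep S' = - dep S.
Proof.
move=> uS uS'; have [h1 h2] := sup_diffs_reflect_le uS uS'.
have [h3 h4] : sup (diffs S' (Pi_ S')) <= sup (diffs (Pi_ S) S) /\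
  sup (diffs (Pi_ S') S') <= sup (diffs S (Pi_ S)).
  (* The reverse inequalities come from reflecting [- Y] back to [Y]. *)
  by apply: (sup_diffs_reflect_le uS'); rewrite opprK.
by rewrite /dep; lra.
Qed.

(** * Almost sure monotone functional dependence *)

Lemma pr_setI1 A N : measurable A -> measurable N -> pr N = 1 -> pr (A `&` N) = pr A.
Proof.
move=> mA mN N1.
have := pr_2incr mA measurableT mN measurableT (@subsetT _ _) (@subsetT _ _).
rewrite !setTI !setIT prT N1.
have := le_pr (measurableI _ _ mA mN) mA (@subIsetl _ _ _); lra.
Qed.

Lemma pr_sub_as A B N : measurable A -> measurable B -> measurable N -> pr N = 1 ->
  A `&` N `<=` B -> pr A <= pr B.
Proof.
by move=> mA mB mN N1 h; rewrite -(pr_setI1 mA mN N1) le_pr //; exact: measurableI.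
Qed.

Section functional_dependence.
Variables (X Y : {RV P >-> R}) (phi : R -> R) (S : subcopula R).
Hypotheses (Yphi : P [set w | Y w = phi (X w)] = 1%E) (uS : underlying X Y S).

Let N : set T := [set w | Y w = phi (X w)].

Let N1 : pr N = 1. Proof. by rewrite Yphi. Qed.

(** [N] is the preimage of [true] under the test [Y = phi (X)]. Measurability of [phi] will come
    from its monotonicity. *)
Let measurable_N : measurable_fun setT phi -> measurable N.
Proof.
move=> mphi.
have := @measurable_fun_eqr _ _ R setT Y (phi \o X) (@measurable_funPT _ _ _ _ Y)
  (measurableT_comp mphi (@measurable_funPT _ _ _ _ X)) measurableT [set true] I.
rewrite setTI; congr measurable.
by apply/seteqP; split=> w /= /eqP.
Qed.

Lemma nondecreasing_dependence : {homo phi : x y / x <= y} -> sceq S (M_ S).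
Proof.
move=> hphi; have mN : measurable N.
  by apply: measurable_N; exact: nondecreasing_measurable.
have [d1 d2 E] := uS; split=> // u v hu hv; apply/eqP; rewrite eq_le.
rewrite subcopula_le_M //; move: hu hv; rewrite d1 d2 => -[x _ <-] [y _ <-].
rewrite -E /= ge_min jdfE !dfE.
have [h|/existsNP[w /not_implyP[[w1 w2] w3]]] :=
    pselect (lev X x `&` N `<=` lev X x `&` lev Y y).
  apply/orP; left; apply: (pr_sub_as _ _ mN N1 h) => //; exact: measurableI.
(* Here [w] in [N] has [X w <= x] but [Y w > y]. A point [w'] of [N] with [Y w' <= y] and [X w' > x]
   would give [Y w <= Y w' <= y], so within [N] the event on [Y] is contained in the one on [X]. *)
apply/orP; right; apply: (pr_sub_as _ _ mN N1) => //; first exact: measurableI.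
move=> w' [w1' w2']; split=> //; rewrite /lev /= leNgt; apply/negP => xw'.
apply: w3; split=> //; move: w1' w1; rewrite /lev /= w2 w2' => w1' w1.
apply: le_trans w1'; rewrite lee_fin hphi // -lee_fin.
exact: le_trans (ltW xw').
Qed.

Lemma nonincreasing_dependence : {homo phi : x y /~ x <= y} -> sceq S (W_ S).
Proof.
move=> hphi; have mN : measurable N by apply: measurable_N;
  apply: nonincreasing_measurable => // a b; exact: hphi.
have [d1 d2 E] := uS; split=> // u v hu hv; apply/eqP; rewrite eq_le.
rewrite W_le_subcopula // andbT; move: hu hv; rewrite d1 d2 => -[x _ <-] [y _ <-].
rewrite -E /= le_max jdfE !dfE; apply/orP.
have [h|/existsNP[w /not_implyP[[[w1 w2] w3] _]]] :=
    pselect ((lev X x `&` lev Y y) `&` N `<=` set0).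
  by right; rewrite -pr0; apply: (pr_sub_as _ _ mN N1 h) => //; exact: measurableI.
left.
(* A point [w] of [N] lies in both events. If [w'] in [N] lay in neither, [X w <= x < X w'] would
   give [Y w' <= Y w <= y]; so the two events cover [N], and inclusion-exclusion bounds the joint
   mass by [u + v - 1]. *)
have : 1 <= pr (lev X x `|` lev Y y).
  rewrite -N1; apply: le_pr => //; first exact: measurableU.
  move=> w' Nw'; apply/orP; rewrite -[_ || _]negbK negb_or -!ltNge.
  apply/negP => /andP[xw' yw']; move: yw' w2; rewrite Nw' /lev /= w3 => yw'.
  move/le_lt_trans => /(_ _ yw'); rewrite lte_fin ltNge hphi // -lee_fin.
  by apply: ltW; apply: le_lt_trans xw'.
rewrite (@prDI (_ `|` _) (lev X x)) //; last exact: measurableU.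
rewrite setUK (@prDI (lev Y y) (lev X x)) // setDUl setDv set0U.
rewrite [_ `&` lev X x]setIC; lra.
Qed.

End functional_dependence.

(** * Independence and quadrant dependence *)

Lemma independent_dep X Y S : underlying X Y S -> independent X Y -> dep S = 0.
Proof.
move=> [d1 d2 E] ind; rewrite -(dep_Pi S); apply: sceq_dep; split=> // u v.
rewrite d1 d2 => -[x _ <-] [y _ <-] /=; rewrite -E jdfE.
(* [lev] is a preimage of a measurable ray, infinite endpoints included, so independence gives
   [S = Pi] on the whole domain without case distinction. *)
rewrite (ind _ _ (measurable_ray x) (measurable_ray y)).
by rewrite fineM ?fin_num_measure //; exact: measurable_lev.
Qed.

Lemma levE X (x : R) : [set w | X w <= x] = lev X x%:E.
Proof. by apply/seteqP; split=> w; rewrite /lev /= lee_fin. Qed.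

Lemma jlevE X Y (x y : R) :
  [set w | X w <= x /\ Y w <= y] = lev X x%:E `&` lev Y y%:E.
Proof. by rewrite -!levE. Qed.

Lemma PQD_dep_ge0 X Y S : underlying X Y S -> PQD X Y -> 0 <= dep S.
Proof.
move=> [d1 d2 E] h; apply: Pi_le_dep_ge0 => u v.
rewrite d1 d2 => -[x _ <-] [y _ <-]; rewrite -E.
(* [PQD] speaks of finite thresholds only; at an infinite one the two sides are equal. *)
case: x => [x| |]; last 2 first.
- by rewrite df_pinfty jdfC jdf_pinfty mul1r.
- by rewrite df_ninfty jdfC jdf_ninfty mul0r.
case: y => [y| |]; last 2 first.
- by rewrite df_pinfty jdf_pinfty mulr1.
- by rewrite df_ninfty jdf_ninfty mulr0.
have mXY := measurableI _ _ (measurable_lev X x%:E) (measurable_lev Y y%:E).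
have := h x y; rewrite !levE jlevE (prE mXY) (prE (measurable_lev X _)).
by rewrite (prE (measurable_lev Y _)).
Qed.

Lemma NQD_dep_le0 X Y S : underlying X Y S -> NQD X Y -> dep S <= 0.
Proof.
move=> [d1 d2 E] h; apply: le_Pi_dep_le0 => u v.
rewrite d1 d2 => -[x _ <-] [y _ <-]; rewrite -E.
case: x => [x| |]; last 2 first.
- by rewrite df_pinfty jdfC jdf_pinfty mul1r.
- by rewrite df_ninfty jdfC jdf_ninfty mul0r.
case: y => [y| |]; last 2 first.
- by rewrite df_pinfty jdf_pinfty mulr1.
- by rewrite df_ninfty jdf_ninfty mulr0.
have mXY := measurableI _ _ (measurable_lev X x%:E) (measurable_lev Y y%:E).
have := h x y; rewrite !levE jlevE (prE mXY) (prE (measurable_lev X _)).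
by rewrite (prE (measurable_lev Y _)).
Qed.

End random_variables_theory.

Theorem theorem1 (R : realType) (d : measure_display) (T : measurableType d)
    (P : probability T R) :
  (* (a) *)
  (forall X Y : {RV P >-> R},
     [/\ exists S, underlying X Y S,
         forall S S', underlying X Y S -> underlying X Y S' -> sceq S S',
         forall S, underlying X Y S -> mu_meaningful S &
         exists! m, is_mu_rv X Y m]) /\
  (* (b) *)
  (forall X Y : {RV P >-> R}, nontrivial_rv X Y -> -1 <= mu_rv X Y <= 1) /\
  (forall X : {RV P >-> R}, nontrivial_rv X X -> mu_rv X X = 1) /\
  (forall X : {RV P >-> R}, nontrivial_rv X (- X) -> mu_rv X (- X) = -1) /\
  (* (c) *)
  (forall X Y : {RV P >-> R}, nontrivial_rv X Y -> nontrivial_rv Y X ->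
     mu_rv X Y = mu_rv Y X) /\
  (* (d) *)
  (forall X Y : {RV P >-> R}, nontrivial_rv X Y ->
     independent X Y -> mu_rv X Y = 0) /\
  (* (e) *)
  (forall X Y : {RV P >-> R}, nontrivial_rv X Y -> mu_rv X Y != 0 ->
     (nontrivial_rv X (- Y) ->
        Num.sg (mu_rv X (- Y)) = - Num.sg (mu_rv X Y)) /\
     (nontrivial_rv (- X) Y ->
        Num.sg (mu_rv (- X) Y) = - Num.sg (mu_rv X Y))) /\
  (* (f) *)
  (forall S1 S2 : subcopula R, nontrivial S1 -> nontrivial S2 ->
     dom1 S1 = dom1 S2 -> dom2 S1 = dom2 S2 ->
     (forall u v, dom1 S1 u -> dom2 S1 v -> S1 u v <= S2 u v) ->
     mu S1 <= mu S2) /\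
  (* (g) *)
  (forall (X Y : {RV P >-> R}) (phi : R -> R), nontrivial_rv X Y ->
     P [set w | Y w = phi (X w)] = 1%E ->
     ({homo phi : x y / x <= y} -> mu_rv X Y = 1) /\
     ({homo phi : x y /~ x <= y} -> mu_rv X Y = -1)) /\
  (* (h) *)
  (forall X Y : {RV P >-> R}, nontrivial_rv X Y ->
     (PQD X Y -> 0 <= mu_rv X Y) /\
     (NQD X Y -> mu_rv X Y <= 0)).
Proof.
have sg_opp (X Y : {RV P >-> R}) S S' :
    nontrivial S -> nontrivial S' -> dep S' = - dep S ->
    underlying X Y S ->
    Num.sg (mu_val S') = - Num.sg (mu_rv X Y).
  by move=> nt nt' e uS; rewrite (mu_rvE uS) !sgr_mu_val // e sgrN.
(* Proved ahead of its place because the values for [(X, X)] and [(X, - X)] in (b) are the instances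
   where [phi] is the identity and the negation. *)
have monotone_dep (X Y : {RV P >-> R}) (phi : R -> R) : nontrivial_rv X Y ->
     P [set w | Y w = phi (X w)] = 1%E ->
     ({homo phi : x y / x <= y} -> mu_rv X Y = 1) /\
     ({homo phi : x y /~ x <= y} -> mu_rv X Y = -1).
  move=> [S uS nt] Yphi; rewrite (mu_rvE uS); split=> hphi.
    by apply: mu_val_M => //; exact: nondecreasing_dependence Yphi uS hphi.
  by apply: mu_val_W => //; exact: nonincreasing_dependence Yphi uS hphi.
have PT : P setT = 1%E := probability_setT P.
split; [|split; [|split; [|split; [|split; [|split; [|split; [|split; [|split]]]]]]]].
- move=> X Y; have [S uS] := sklar X Y; split.
  + by exists S.
  + exact: underlying_sceq.
  + by move=> S' _; exact: mu_meaningfulP.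
  + exists (mu_val S); split; first exact/(is_mu_rvE _ uS).
    by move=> m /(is_mu_rvE _ uS).
- by move=> X Y [S uS nt]; rewrite (mu_rvE uS) mu_val_bound.
- move=> X nt; apply: (monotone_dep X X id nt _).1 => //.
  by rewrite -PT; congr (P _); apply/seteqP; split.
- move=> X nt; apply: (monotone_dep X (- X) -%R nt _).2.
    by rewrite -PT; congr (P _); apply/seteqP; split.
  by move=> x y; rewrite lerN2.
- move=> X Y [S uS _] [S' uS' _]; rewrite (mu_rvE uS) (mu_rvE uS').
  have [e1 e2 e] := underlying_transpose uS' uS; exact: mu_val_transpose.
- move=> X Y [S uS nt] ind; rewrite (mu_rvE uS); apply/eqP.
  by rewrite -sgr_eq0 sgr_mu_val // (independent_dep uS ind) sgr0.
- move=> X Y [S uS nt] _; split=> -[S' uS' nt']; rewrite (mu_rvE uS').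
    exact: sg_opp (dep_reflect uS uS') uS.
  (* Reflecting the first variable reduces to the second by transposing twice: [(- X, Y)] has the
     [dep] of [(Y, - X)], which is opposite to that of [(Y, X)], hence to that of [(X, Y)]. *)
  have [S1 uS1] := sklar Y X; have [S2 uS2] := sklar Y (- X).
  have [a1 a2 a3] := underlying_transpose uS uS1.
  have [b1 b2 b3] := underlying_transpose uS' uS2.
  apply: sg_opp uS => //.
  by rewrite -(dep_transpose a1 a2 a3) -(dep_transpose b1 b2 b3);
    exact: dep_reflect uS1 uS2.
- by move=> S1 S2 nt1 _ e1 e2 h; rewrite !muE le_mu_val.
- exact: monotone_dep.
- move=> X Y [S uS nt]; rewrite (mu_rvE uS); split=> h.
    by apply: mu_val_ge0 => //; exact: PQD_dep_ge0 uS h.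
  by apply: mu_val_le0 => //; exact: NQD_dep_le0 uS h.
Qed.
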